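(* Let $\mathfrak s$ be a $6$-dimensional real Lie algebra with an abelian complex structure $J$ such that $\mathfrak s'_J$ is $4$-dimensional and non-abelian. Then $(\mathfrak s,J)$ is holomorphically isomorphic to one of the following (each with the product complex structure): \begin{enumerate} \item $\mathfrak{aff}(\mathbb R)\times(\mathfrak h_3\times\mathbb R)$, with the unique complex structure on each of the factors $\mathfrak{aff}(\mathbb R)$ and $\mathfrak h_3\times\mathbb R$; \item $\mathfrak{aff}(\mathbb R)\times\mathfrak{aff}(\mathbb C)$, where $\mathfrak{aff}(\mathbb R)$ carries its unique complex structure and $\mathfrak{aff}(\mathbb C)$ carries $J_1$; \item $\mathfrak{aff}(\mathbb R)\times\mathfrak{aff}(\mathbb R)\times\mathbb R^2$, where each factor carries its unique complex structure; \item $(\mathfrak{aff}(\mathbb R)\ltimes_{\mathrm{ad}}\mathbb R^2)\times\mathbb R^2$, where each factor is equipped with its unique abelian complex structure; \item $\mathfrak{aff}(\mathbb C)\times\mathbb R^2$, where the first factor is equipped with $J_2$ and $\mathbb R^2$ with its unique complex structure. \end{enumerate}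
   Context: An abelian complex structure on a real Lie algebra $\mathfrak g$ is a linear endomorphism $J$ with $J^2=-I$ and $[Jx,Jy]=[x,y]$ for all $x,y\in\mathfrak g$. Write $\mathfrak s'=[\mathfrak s,\mathfrak s]$ and $\mathfrak s'_J=\mathfrak s'+J\mathfrak s'$. Two pairs $(\mathfrak g_1,J_1)$, $(\mathfrak g_2,J_2)$ are holomorphically isomorphic if there is a Lie algebra isomorphism $\alpha:\mathfrak g_1\to\mathfrak g_2$ with $J_2\alpha=\alpha J_1$. ''Unique'' complex structure means unique up to automorphisms of the Lie algebra. Lie algebras (nonzero brackets, up to skew-symmetry) and complex structures on the factors: $\mathfrak{aff}(\mathbb R)$: $[e_1,e_2]=e_2$, $Je_1=e_2$; $\mathbb R^2$: abelian, any $J$ with $J^2=-I$; $\mathfrak h_3\times\mathbb R$: $[e_1,e_2]=e_3$, $Je_1=e_2$, $Je_3=e_4$; $\mathfrak{aff}(\mathbb R)\ltimes_{\mathrm{ad}}\mathbb R^2$: $[e_1,e_2]=e_2$, $[e_1,e_4]=e_4$, $[e_2,e_3]=e_4$, $Je_1=e_2$, $Je_3=-e_4$; $\mathfrak{aff}(\mathbb C)$: $[e_1,e_3]=e_3$, $[e_1,e_4]=e_4$, $[e_2,e_3]=e_4$, $[e_2,e_4]=-e_3$, with $J_1e_1=-e_2$, $J_1e_3=e_4$ and $J_2e_1=e_3$, $J_2e_2=e_4$. *)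

(* Defs.v *)
From HB Require Import structures.
From mathcomp Require Import all_boot all_order all_algebra.
From mathcomp Require Import ring.

Set Implicit Arguments.
Unset Strict Implicit.
Unset Printing Implicit Defensive.

Import GRing.Theory.
Local Open Scope ring_scope.

HB.mixin Record Vector_isLieAlgebra (F : fieldType) V of Vector F V := {
  lie : V -> V -> V;
  lie_linearl : forall y, linear (fun x => lie x y);
  lie_linearr : forall x, linear (lie x);
  lie_alternating : forall x, lie x x = 0;
  lie_jacobi : forall x y z,
    lie x (lie y z) + lie y (lie z x) + lie z (lie x y) = 0
}.

#[short(type="lieAlgType")]
HB.structure Definition LieAlgebra (F : fieldType) :=
  {V of Vector_isLieAlgebra F V & Vector F V}.

Section LieTheory.
Variables (F : fieldType) (V : lieAlgType F).

HB.instance Definition _ (x : V) :=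
  GRing.isLinear.Build F V V *:%R (lie x) (lie_linearr x).

Lemma lieC (x y : V) : lie x y = - lie y x.
Proof.
have lD u v w : lie (u + v) w = lie u w + lie v w.
  by rewrite -[u in LHS]scale1r lie_linearl scale1r.
apply/eqP; rewrite -addr_eq0; apply/eqP.
have := lie_alternating (x + y).
by rewrite lD !linearD /= !lie_alternating add0r addr0.
Qed.

(* The subspace [U, W]; as for prodv in falgebra, brackets of bases suffice,
   see memv_commutator and commutator_subP. *)
Definition commutator (U W : {vspace V}) : {vspace V} :=
  <<[seq lie x y | x <- vbasis U, y <- vbasis W]>>%VS.

Lemma memv_commutator (U W : {vspace V}) x y :
  x \in U -> y \in W -> lie x y \in commutator U W.
Proof.
move=> Ux Wy; rewrite (coord_vbasis Ux) (coord_vbasis Wy).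
rewrite linear_sum; apply: memv_suml => j _; rewrite linearZ /=; apply: memvZ.
rewrite lieC memvN linear_sum; apply: memv_suml => i _; rewrite linearZ /=.
apply: memvZ; rewrite lieC memvN; apply: memv_span; apply: allpairs_f.
  by rewrite -tnth_nth mem_tnth.
by rewrite -tnth_nth mem_tnth.
Qed.

Lemma commutator_subP (U W X : {vspace V}) :
  (forall x y, x \in U -> y \in W -> lie x y \in X) <->
  (commutator U W <= X)%VS.
Proof.
split=> [h|/subvP h x y Ux Wy]; last exact/h/memv_commutator.
apply/span_subvP => _ /allpairsP[[x y] /= [xU yW ->]].
by apply: h; apply: vbasis_mem.
Qed.

Definition derived_algebra : {vspace V} := commutator fullv fullv.

Definition derived_algebra_J (J : 'End(V)) : {vspace V} :=
  (derived_algebra + J @: derived_algebra)%VS.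

Definition abelian_subspace (U : {vspace V}) : Prop :=
  forall x y, x \in U -> y \in U -> lie x y = 0.

Definition abelian_complex_structure (J : 'End(V)) : Prop :=
  (forall x, J (J x) = - x) /\ (forall x y, lie (J x) (J y) = lie x y).

End LieTheory.

Definition holomorphically_isomorphic (F : fieldType) (V W : lieAlgType F)
    (J : 'End(V)) (K : 'End(W)) : Prop :=
  exists f : 'Hom(V, W),
    [/\ bijective f,
        forall x y, f (lie x y) = lie (f x) (f y)
      & forall x, K (f x) = f (J x)].

Section Product.
Variables (F : fieldType) (V W : lieAlgType F).

Definition prod_lie (x y : V * W) : V * W := (lie x.1 y.1, lie x.2 y.2).

Fact prod_lie_linearl y : linear (fun x => prod_lie x y).
Proof. by move=> a x x'; congr pair; apply: lie_linearl. Qed.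

Fact prod_lie_linearr x : linear (prod_lie x).
Proof. by move=> a y y'; congr pair; apply: lie_linearr. Qed.

Fact prod_lie_alternating x : prod_lie x x = 0.
Proof. by congr pair; apply: lie_alternating. Qed.

Fact prod_lie_jacobi x y z :
  prod_lie x (prod_lie y z) + prod_lie y (prod_lie z x)
    + prod_lie z (prod_lie x y) = 0.
Proof. by congr pair; apply: lie_jacobi. Qed.

HB.instance Definition _ := Vector_isLieAlgebra.Build F (V * W)%type
  prod_lie_linearl prod_lie_linearr prod_lie_alternating prod_lie_jacobi.

Definition prod_end_fun (J : 'End(V)) (K : 'End(W)) (x : V * W) : V * W :=
  (J x.1, K x.2).

Fact prod_end_fun_linear J K : linear (prod_end_fun J K).
Proof. by move=> a x y; congr pair; rewrite linearP. Qed.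

HB.instance Definition _ J K := GRing.isLinear.Build F (V * W)%type (V * W)%type
  *:%R (prod_end_fun J K) (prod_end_fun_linear J K).

Definition prod_end (J : 'End(V)) (K : 'End(W)) : 'End((V * W)%type) :=
  linfun (prod_end_fun J K).

Lemma prod_end_abelian J K :
  abelian_complex_structure J -> abelian_complex_structure K ->
  abelian_complex_structure (prod_end J K).
Proof.
move=> [J2 JJ] [K2 KK]; split=> [x|x y]; rewrite !(lfunE (prod_end_fun J K)) /=.
  by congr pair; rewrite /= ?J2 ?K2.
by congr pair; rewrite /= ?JJ ?KK.
Qed.

End Product.

Section StructureConstants.
Variables (F : fieldType) (n : nat).
Implicit Types (x y : 'rV[F]_n.+1) (t : seq (nat * nat * 'rV[F]_n.+1)).

(* Indices of basis vectors start at 1. *)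
Definition e (i : nat) : 'rV[F]_n.+1 := \row_j (j.+1 == i)%:R.

Definition coeff x (i : nat) : F := x 0 (inord i.-1).

(* An entry (i, j, v) of t stands for [e_i, e_j] = v = - [e_j, e_i]; the
   brackets of basis vectors that are not listed vanish. *)
Definition table_lie t x y : 'rV[F]_n.+1 :=
  \sum_(b <- t)
    (coeff x b.1.1 * coeff y b.1.2 - coeff x b.1.2 * coeff y b.1.1) *: b.2.

Lemma coeffP x y :
  (forall i, (i <= n)%N -> coeff x i.+1 = coeff y i.+1) -> x = y.
Proof.
move=> h; apply/rowP => i; have := h i; rewrite -ltnS ltn_ord /coeff /=.
by rewrite inord_val; apply.
Qed.

Lemma coeff_e i j : (j <= n)%N -> coeff (e i) j.+1 = (j.+1 == i)%:R.
Proof. by move=> jn; rewrite /coeff mxE inordK. Qed.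

Lemma coeff0 i : coeff 0 i = 0.
Proof. exact: mxE. Qed.

Lemma coeffD x y i : coeff (x + y) i = coeff x i + coeff y i.
Proof. exact: mxE. Qed.

Lemma coeffZ a x i : coeff (a *: x) i = a * coeff x i.
Proof. exact: mxE. Qed.

Lemma coeffN x i : coeff (- x) i = - coeff x i.
Proof. exact: mxE. Qed.

Lemma coeff_Ne i j : (j <= n)%N -> coeff (- e i) j.+1 = - (j.+1 == i)%:R.
Proof. by move=> jn; rewrite coeffN coeff_e. Qed.

Lemma coeff_table_lie t x y i : coeff (table_lie t x y) i =
  foldr (fun b c =>
    (coeff x b.1.1 * coeff y b.1.2 - coeff x b.1.2 * coeff y b.1.1)
      * coeff b.2 i + c) 0 t.
Proof.
rewrite /table_lie; elim: t => [|b t IH]; first by rewrite big_nil coeff0.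
by rewrite big_cons coeffD coeffZ IH.
Qed.

Fact table_lie_linearl t y : linear (fun x => table_lie t x y).
Proof.
move=> a x x'; rewrite /table_lie scaler_sumr -big_split /=.
apply: eq_bigr => b _; rewrite scalerA -scalerDl /coeff !mxE.
by congr (_ *: _); ring.
Qed.

Fact table_lie_linearr t x : linear (table_lie t x).
Proof.
move=> a y y'; rewrite /table_lie scaler_sumr -big_split /=.
apply: eq_bigr => b _; rewrite scalerA -scalerDl /coeff !mxE.
by congr (_ *: _); ring.
Qed.

Fact table_lie_alternating t x : table_lie t x x = 0.
Proof.
rewrite /table_lie big1 // => b _.
by rewrite [X in X - _]mulrC subrr scale0r.
Qed.

Definition table_end_fun (s : seq 'rV[F]_n.+1) x : 'rV[F]_n.+1 :=
  \sum_(0 <= i < n.+1) coeff x i.+1 *: nth 0 s i.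

Fact table_end_fun_linear s : linear (table_end_fun s).
Proof.
move=> a x y; rewrite /table_end_fun scaler_sumr -big_split /=.
by apply: eq_bigr => i _; rewrite scalerA -scalerDl /coeff !mxE.
Qed.

HB.instance Definition _ s := GRing.isLinear.Build F 'rV[F]_n.+1 'rV[F]_n.+1
  *:%R (table_end_fun s) (table_end_fun_linear s).

Lemma coeff_table_end s x i : coeff (table_end_fun s x) i =
  foldr (fun j c => coeff x j.+1 * coeff (nth 0 s j) i + c) 0 (iota 0 n.+1).
Proof.
rewrite /table_end_fun /index_iota subn0.
elim: iota => [|j r IH]; first by rewrite big_nil coeff0.
by rewrite big_cons coeffD coeffZ IH.
Qed.

(* The endomorphism sending e_i to the i-th vector of s. *)
Definition table_end (s : seq 'rV[F]_n.+1) : 'End('rV[F]_n.+1) :=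
  linfun (table_end_fun s).

End StructureConstants.

Arguments e {F n} i%_N.
Arguments coeff {F n} x i%_N.

Ltac table_jacobi x y z :=
  apply: coeffP => -[|[|[|[|?]]]] // _;
  rewrite coeff0 2!coeffD !coeff_table_lie /= ?coeff_table_lie /=;
  move: (coeff x) (coeff y) (coeff z) => f g h;
  rewrite ?(coeff_e, coeff_Ne) //=; ring.

Ltac table_complex x :=
  rewrite !(lfunE (table_end_fun _));
  apply: coeffP => -[|[|[|[|?]]]] // _;
  rewrite [RHS]coeffN !coeff_table_end /= !coeff_table_end /=;
  move: (coeff x) => f; rewrite ?(coeff_e, coeff_Ne) //=; ring.

Ltac table_abelian x y :=
  rewrite !(lfunE (table_end_fun _)) /lie /=;
  apply: coeffP => -[|[|[|[|?]]]] // _;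
  rewrite !coeff_table_lie /= ?coeff_table_end /=;
  move: (coeff x) (coeff y) => f g; rewrite ?(coeff_e, coeff_Ne) //=; ring.

Section Models.
Variable F : fieldType.

Definition aff_R : Type := 'rV[F]_2.
HB.instance Definition _ := Vector.on aff_R.

Definition aff_R_lie : aff_R -> aff_R -> aff_R :=
  table_lie [:: ((1, 2)%N, e 2)].

Fact aff_R_jacobi x y z :
  aff_R_lie x (aff_R_lie y z) + aff_R_lie y (aff_R_lie z x)
    + aff_R_lie z (aff_R_lie x y) = 0.
Proof. by rewrite /aff_R_lie; table_jacobi x y z. Qed.

HB.instance Definition _ := Vector_isLieAlgebra.Build F aff_R
  (table_lie_linearl _) (table_lie_linearr _) (table_lie_alternating _)
  aff_R_jacobi.

Definition aff_R_J : 'End(aff_R) := table_end [:: e 2; - e 1].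

Lemma aff_R_J_abelian : abelian_complex_structure aff_R_J.
Proof. by split=> [x|x y]; [table_complex x | table_abelian x y]. Qed.

Definition R2 : Type := 'rV[F]_2.
HB.instance Definition _ := Vector.on R2.

Definition R2_lie : R2 -> R2 -> R2 := table_lie [::].

Fact R2_jacobi x y z :
  R2_lie x (R2_lie y z) + R2_lie y (R2_lie z x)
    + R2_lie z (R2_lie x y) = 0.
Proof. by rewrite /R2_lie; table_jacobi x y z. Qed.

HB.instance Definition _ := Vector_isLieAlgebra.Build F R2
  (table_lie_linearl _) (table_lie_linearr _) (table_lie_alternating _)
  R2_jacobi.

(* All complex structures on R^2 are conjugate, so one may be fixed. *)
Definition R2_J : 'End(R2) := table_end [:: e 2; - e 1].

Lemma R2_J_abelian : abelian_complex_structure R2_J.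
Proof. by split=> [x|x y]; [table_complex x | table_abelian x y]. Qed.

Definition h3_R : Type := 'rV[F]_4.
HB.instance Definition _ := Vector.on h3_R.

Definition h3_R_lie : h3_R -> h3_R -> h3_R :=
  table_lie [:: ((1, 2)%N, e 3)].

Fact h3_R_jacobi x y z :
  h3_R_lie x (h3_R_lie y z) + h3_R_lie y (h3_R_lie z x)
    + h3_R_lie z (h3_R_lie x y) = 0.
Proof. by rewrite /h3_R_lie; table_jacobi x y z. Qed.

HB.instance Definition _ := Vector_isLieAlgebra.Build F h3_R
  (table_lie_linearl _) (table_lie_linearr _) (table_lie_alternating _)
  h3_R_jacobi.

Definition h3_R_J : 'End(h3_R) := table_end [:: e 2; - e 1; e 4; - e 3].

Lemma h3_R_J_abelian : abelian_complex_structure h3_R_J.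
Proof. by split=> [x|x y]; [table_complex x | table_abelian x y]. Qed.

(* The semidirect product of aff(R) with R^2 by the adjoint action. *)
Definition aff_R_ad : Type := 'rV[F]_4.
HB.instance Definition _ := Vector.on aff_R_ad.

Definition aff_R_ad_lie : aff_R_ad -> aff_R_ad -> aff_R_ad :=
  table_lie [:: ((1, 2)%N, e 2); ((1, 4)%N, e 4); ((2, 3)%N, e 4)].

Fact aff_R_ad_jacobi x y z :
  aff_R_ad_lie x (aff_R_ad_lie y z) + aff_R_ad_lie y (aff_R_ad_lie z x)
    + aff_R_ad_lie z (aff_R_ad_lie x y) = 0.
Proof. by rewrite /aff_R_ad_lie; table_jacobi x y z. Qed.

HB.instance Definition _ := Vector_isLieAlgebra.Build F aff_R_ad
  (table_lie_linearl _) (table_lie_linearr _) (table_lie_alternating _)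
  aff_R_ad_jacobi.

Definition aff_R_ad_J : 'End(aff_R_ad) := table_end [:: e 2; - e 1; - e 4; e 3].

Lemma aff_R_ad_J_abelian : abelian_complex_structure aff_R_ad_J.
Proof. by split=> [x|x y]; [table_complex x | table_abelian x y]. Qed.

Definition aff_C : Type := 'rV[F]_4.
HB.instance Definition _ := Vector.on aff_C.

Definition aff_C_lie : aff_C -> aff_C -> aff_C :=
  table_lie [:: ((1, 3)%N, e 3); ((1, 4)%N, e 4);
                ((2, 3)%N, e 4); ((2, 4)%N, - e 3)].

Fact aff_C_jacobi x y z :
  aff_C_lie x (aff_C_lie y z) + aff_C_lie y (aff_C_lie z x)
    + aff_C_lie z (aff_C_lie x y) = 0.
Proof. by rewrite /aff_C_lie; table_jacobi x y z. Qed.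

HB.instance Definition _ := Vector_isLieAlgebra.Build F aff_C
  (table_lie_linearl _) (table_lie_linearr _) (table_lie_alternating _)
  aff_C_jacobi.

Definition aff_C_J1 : 'End(aff_C) := table_end [:: - e 2; e 1; e 4; - e 3].

Definition aff_C_J2 : 'End(aff_C) := table_end [:: e 3; e 4; - e 1; - e 2].

Lemma aff_C_J1_abelian : abelian_complex_structure aff_C_J1.
Proof. by split=> [x|x y]; [table_complex x | table_abelian x y]. Qed.

Lemma aff_C_J2_abelian : abelian_complex_structure aff_C_J2.
Proof. by split=> [x|x y]; [table_complex x | table_abelian x y]. Qed.

End Models.

(* Main.v *)
(* Ito's argument for sums of two abelian subalgebras, applied to the
   complexification, shows that the derived algebra A = s' is abelian. Then
   x ** y = [J x, y] is a commutative associative product on A, which is nonzero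
   because A + J A is not abelian. For f outside A + J A, the operators P = ad f
   and Q = ad (J f) of A commute with this product and with each other, and
   P^2 + Q^2 is multiplication by -[f, J f]; moreover A is spanned by A ** A,
   P A, Q A and [f, J f]. These relations exclude nilpotent A. If a is a nonzero
   idempotent, f can be shifted by an element of A + J A so that P a = Q a = 0,
   and then s is the product of the part attached to a ** A and the part
   attached to the annihilator of a. If dim A = 2, either A has a unit, and
   is the dual numbers, R x R or C, or A is R a + R n with n ** A = 0. If
   dim A = 3, the annihilator A :&: J A of A is a complex line on which P acts by
   a complex scalar. *)

Require Import Defs.
From HB Require Import structures.
From mathcomp Require Import all_boot all_order all_algebra.
From mathcomp Require Import boolp reals ring lra.

Set Implicit Arguments.
Unset Strict Implicit.
Unset Printing Implicit Defensive.

Import Order.TTheory GRing.Theory Num.Theory.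
Local Open Scope ring_scope.

(** * Vector identities tested on functionals *)

(** Coordinates separate vectors. The functional [p] is a bare function with linearity given as
    equations, so that rewriting yields a scalar identity within reach of [ring], [field] and
    [lra]. *)
Lemma vect_ext (R : fieldType) (V : vectType R) (u v : V) :
  (forall p : V -> R, (forall x y, p (x + y) = p x + p y) ->
     (forall a x, p (a *: x) = a * p x) -> (forall x, p (- x) = - p x) ->
     p 0 = 0 -> p u = p v) ->
  u = v.
Proof.
move=> h; rewrite (coord_vbasis (memvf u)) (coord_vbasis (memvf v)).
apply: eq_bigr => i _; congr (_ *: _).
by apply: h => [x y|a x|x|]; rewrite ?(linearD, linearZ, linearN, linear0).
Qed.

Ltac vect_coord :=
  let p := fresh "p" in let pD := fresh in let pZ := fresh in
  let pN := fresh in let p0 := fresh in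
  apply: vect_ext => p pD pZ pN p0; rewrite ?(pD, pZ, pN, p0).
Ltac vring := vect_coord; ring.
Ltac vfield := vect_coord; by field.

(** * The derived algebra is abelian *)

Section AbelianComplexStructure.
Variables (R : rcfType) (V : lieAlgType R) (J : 'End(V)).
Hypothesis acs : abelian_complex_structure J.
Implicit Types x y z w : V.

Lemma lieDr x y z : lie x (y + z) = lie x y + lie x z.
Proof. exact: linearD. Qed.
Lemma lieNr x y : lie x (- y) = - lie x y.
Proof. exact: linearN. Qed.
Lemma lieZr a x y : lie x (a *: y) = a *: lie x y.
Proof. exact: linearZ. Qed.
Lemma lie0r x : lie x 0 = 0.
Proof. exact: linear0. Qed.
Lemma lieDl x y z : lie (x + y) z = lie x z + lie y z.
Proof. by rewrite lieC lieDr opprD -!lieC. Qed.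
Lemma lieNl x y : lie (- x) y = - lie x y.
Proof. by rewrite lieC lieNr -lieC. Qed.
Lemma lieZl a x y : lie (a *: x) y = a *: lie x y.
Proof. by rewrite lieC lieZr -scalerN -lieC. Qed.
Lemma lie0l x : lie 0 x = 0.
Proof. by rewrite lieC lie0r oppr0. Qed.

Definition lieE := (lieDl, lieDr, lieNl, lieNr, lieZl, lieZr, lie0l, lie0r).

Lemma JD x y : J (x + y) = J x + J y. Proof. exact: linearD. Qed.
Lemma JZ a x : J (a *: x) = a *: J x. Proof. exact: linearZ. Qed.
Lemma JN x : J (- x) = - J x. Proof. exact: linearN. Qed.
Lemma J0 : J 0 = 0. Proof. exact: linear0. Qed.
Lemma JK x : J (J x) = - x. Proof. by case: acs. Qed.

Definition JE := (JD, JZ, JN, J0, JK).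

Lemma lieJJ x y : lie (J x) (J y) = lie x y. Proof. by case: acs. Qed.

Lemma lieJr x y : lie x (J y) = - lie (J x) y.
Proof. by rewrite -lieJJ JK lieNr. Qed.

Lemma lieJC x y : lie (J x) y = lie (J y) x.
Proof. by rewrite lieC lieJr opprK. Qed.

Lemma lie_leibniz x y z : lie x (lie y z) = lie (lie x y) z + lie y (lie x z).
Proof.
have := lie_jacobi x y z; rewrite [lie z (lie x y)]lieC [lie z x]lieC lieNr.
move=> h; apply: vect_ext => p pD pZ pN p0; move: (congr1 p h).
by rewrite !(pD, pN, p0); lra.
Qed.

(** After the Leibniz rule on both double brackets, the terms in [J x, y] = [J y, x] cancel and the
    Jacobi identity at [b] remains. *)
Lemma lie_curvature x y b :
  lie (J x) (lie y (J b)) - lie (J y) (lie x (J b)) = - lie (lie x y) b.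
Proof.
rewrite [lie (J x) _]lie_leibniz [lie (J y) (lie x _)]lie_leibniz !lieJJ.
by rewrite [lie (J y) x]lieJC [lie x (lie y b)]lie_leibniz; vring.
Qed.

(* The action of the antiholomorphic vector x + i J x on the quotient of the
   complexification by the antiholomorphic vectors, up to a factor. *)
Definition chern x y := lie x y - J (lie x (J y)).

(** Antiholomorphic X and Y commute in the complexification, so [X, [Y, b]] = [Y, [X, b]] for
    holomorphic b. This is the holomorphic component of that identity; [chern_sym] is, up to
    conjugation, the antiholomorphic one. *)
Lemma chernC x y b : chern x (chern y b) = chern y (chern x b).
Proof.
have h1 := lie_curvature x y b; have h2 := lie_curvature x y (J b).
have h3 := lie_leibniz x y b; have h4 := lie_leibniz x y (J b).
rewrite /chern; rewrite ?(lieE, JE, lieJJ, lieJr) in h1 h2 h3 h4 *.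
apply: vect_ext => p pD pZ pN p0.
(* [h1] and [h3] settle the terms without an outer [J]; [h2] and [h4], taken through [p \o J],
   settle those with one. *)
move: (congr1 p h1) (congr1 (p \o J) h2) (congr1 p h3) (congr1 (p \o J) h4) => /=.
rewrite ?(JE, pD, pZ, pN, p0); lra.
Qed.

Lemma chern_sym x y b : chern (chern x b) y = chern (chern y b) x.
Proof.
have h1 := lie_curvature x y b; have h2 := lie_curvature x y (J b).
have h3 := lie_leibniz x y b; have h4 := lie_leibniz x y (J b).
rewrite /chern.
rewrite ![lie _ x]lieC ![lie _ y]lieC ![lie _ (J x)]lieC ![lie _ (J y)]lieC.
rewrite ?(lieE, JE, lieJJ, lieJr) in h1 h2 h3 h4 *.
apply: vect_ext => p pD pZ pN p0.
move: (congr1 p h1) (congr1 (p \o J) h2) (congr1 p h3) (congr1 (p \o J) h4) => /=.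
rewrite ?(JE, pD, pZ, pN, p0); lra.
Qed.

Lemma lie_chern x y : 2 *: lie x y = chern x y - chern y x.
Proof.
by rewrite /chern !lieJr lieJC [lie y x]lieC JE; vring.
Qed.

(** Alternating the two exchange laws reverses the word z w x y while keeping the bracketing. *)
Lemma chern_swap x y z w :
  chern (chern z w) (chern x y) = chern (chern y x) (chern w z).
Proof.
rewrite chernC [chern (chern z w) y]chern_sym chernC.
by rewrite [LHS]chern_sym [chern (chern x z) w]chern_sym [LHS]chern_sym.
Qed.

Lemma chernBB x y z w :
  chern (x - y) (z - w) = chern x z - chern x w - (chern y z - chern y w).
Proof. by rewrite /chern !(lieE, JE); vring. Qed.

(** Ito's argument: [lie_chern], used on all three brackets (hence the factor 8), gives eight
    products of products, which [chern_swap] cancels in pairs. *)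
Lemma lie_metabelian x y z w : lie (lie x y) (lie z w) = 0.
Proof.
have: 8 *: lie (lie x y) (lie z w) = 0.
  have ->: 8 = 2 * (2 * 2) :> R by ring.
  rewrite -!scalerA -[2 *: lie (lie _ _) _]lieZr -lieZl lie_chern !lie_chern.
  rewrite 2!chernBB.
  rewrite (chern_swap x y z w) (chern_swap y x z w).
  by rewrite (chern_swap x y w z) (chern_swap y x w z); vring.
by move/eqP; rewrite scaler_eq0 pnatr_eq0 => /eqP.
Qed.
End AbelianComplexStructure.

(** * Homomorphisms from the model algebras *)

Section LinearCombination.
Variables (R : fieldType) (V : vectType R) (n : nat) (s : seq V).

Definition lincomb_fun (x : 'rV[R]_n.+1) : V :=
  \sum_(0 <= i < n.+1) coeff x i.+1 *: nth 0 s i.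

Fact lincomb_fun_linear : linear lincomb_fun.
Proof.
move=> a x y; rewrite /lincomb_fun scaler_sumr -big_split /=.
by apply: eq_bigr => i _; rewrite scalerA -scalerDl coeffD coeffZ.
Qed.

HB.instance Definition _ := GRing.isLinear.Build R 'rV[R]_n.+1 V
  *:%R lincomb_fun lincomb_fun_linear.

Definition lincomb : 'Hom('rV[R]_n.+1, V) := linfun lincomb_fun.

Lemma lincombE x :
  lincomb x = foldr (fun i v => coeff x i.+1 *: nth 0 s i + v) 0 (iota 0 n.+1).
Proof.
transitivity (lincomb_fun x); first exact: lfunE.
rewrite /lincomb_fun /index_iota subn0.
by elim: iota => [|j r IH]; [rewrite big_nil | rewrite big_cons IH].
Qed.

Lemma limg_lincomb : size s = n.+1 -> limg lincomb = <<s>>%VS.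
Proof.
move=> sz; apply/eqP; rewrite eqEsubv; apply/andP; split.
  apply/subvP => _ /memv_imgP[x _ ->]; rewrite lfunE /= /lincomb_fun big_mkord.
  apply: memv_suml => i _; apply: memvZ; apply: memv_span; apply: mem_nth.
  by rewrite sz.
apply/span_subvP => x /(nthP 0)[i]; rewrite sz => lti <-.
apply/memv_imgP; exists (e i.+1); rewrite ?memvf // lfunE /= /lincomb_fun.
rewrite big_mkord (bigD1 (Ordinal lti)) //= big1 ?addr0 => [|j neq_ji].
  by rewrite coeff_e // eqxx scale1r.
rewrite coeff_e; last by rewrite -ltnS.
rewrite eqSS; case: eqP => [eq_ji|]; last by rewrite scale0r.
by case/eqP: neq_ji; apply: val_inj.
Qed.

End LinearCombination.

Section Models.
Variables (R : rcfType) (V : lieAlgType R) (J : 'End(V)).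
Hypothesis acs : abelian_complex_structure J.

(** Only the image is recorded, so that factors can be assembled by sums of subspaces; injectivity
    comes at the end from a dimension count. *)
Definition holomorphic_image (W : lieAlgType R) (K : 'End(W)) (U : {vspace V}) :=
  exists g : 'Hom(W, V), [/\ forall x y, g (lie x y) = lie (g x) (g y),
    forall x, g (K x) = J (g x) & limg g = U].

Ltac model s :=
  let x := fresh in let y := fresh in
  exists (lincomb _ s); split; last exact: limg_lincomb;
  [ move=> x y; rewrite !lincombE [lie x y]/lie /= !coeff_table_lie /=;
    move: (coeff x) (coeff y) => {}x {}y
  | move=> x; rewrite (lfunE (table_end_fun _)) /= !lincombE /= !coeff_table_end /=;
    move: (coeff x) => {}x ];
  rewrite ?(coeff_e, coeff_Ne) //= ?(JE acs).

Ltac close h :=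
  rewrite ?(addr0, add0r) ?lieE ?(lieJr acs) ?(JK acs) ?lieNl ?lie_alternating ?h;
  vring.

Lemma holomorphic_image_aff_R x : lie x (J x) = J x ->
  holomorphic_image (aff_R_J R) <<[:: x; J x]>>.
Proof.
move=> h; have h' : lie (J x) x = - J x by rewrite lieC h.
by model [:: x; J x]; close h'.
Qed.

Lemma holomorphic_image_R2 x : lie x (J x) = 0 ->
  holomorphic_image (R2_J R) <<[:: x; J x]>>.
Proof.
move=> h; have h' : lie (J x) x = 0 by rewrite lieC h oppr0.
by model [:: x; J x]; close h'.
Qed.

Lemma holomorphic_image_h3_R x z : lie x (J x) = z ->
    lie x z = 0 -> lie (J x) z = 0 -> lie z (J z) = 0 ->
  holomorphic_image (h3_R_J R) <<[:: x; J x; z; J z]>>.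
Proof.
move=> h h1 h2 h3; have h' : lie (J x) x = - z by rewrite lieC h.
have h1' : lie z x = 0 by rewrite lieC h1 oppr0.
have h2' : lie (J z) x = 0 by rewrite (lieJC acs).
have h3' : lie (J z) z = 0 by rewrite lieC h3 oppr0.
by model [:: x; J x; z; J z]; close (h1, h2, h', h1', h2', h3').
Qed.

(** The last basis vector is [- J z] because J e_3 = - e_4 in the model; likewise J_1 e_1 = - e_2
    puts [- J x] second in [holomorphic_image_aff_C_J1]. *)
Lemma holomorphic_image_aff_R_ad x z : lie x (J x) = J x ->
    lie x z = 0 -> lie (J x) z = - J z -> lie z (J z) = 0 ->
  holomorphic_image (aff_R_ad_J R) <<[:: x; J x; z; - J z]>>.
Proof.
move=> h h1 h2 h3; have h' : lie (J x) x = - J x by rewrite lieC h.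
have h1' : lie z x = 0 by rewrite lieC h1 oppr0.
have h2' : lie (J z) x = - J z by rewrite (lieJC acs).
have h3' : lie (J z) z = 0 by rewrite lieC h3 oppr0.
by model [:: x; J x; z; - J z]; close (h1, h2, h', h1', h2', h3').
Qed.

Lemma holomorphic_image_aff_C_J1 x z : lie x (J x) = 0 ->
    lie x z = z -> lie (J x) z = - J z -> lie z (J z) = 0 ->
  holomorphic_image (aff_C_J1 R) <<[:: x; - J x; z; J z]>>.
Proof.
move=> h h1 h2 h3; have h' : lie (J x) x = 0 by rewrite lieC h oppr0.
have h1' : lie z x = - z by rewrite lieC h1.
have h2' : lie (J z) x = - J z by rewrite (lieJC acs).
have h3' : lie (J z) z = 0 by rewrite lieC h3 oppr0.
by model [:: x; - J x; z; J z]; close (h1, h2, h', h1', h2', h3').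
Qed.

Lemma holomorphic_image_aff_C_J2 x y : lie x (J x) = J x ->
    lie x y = 0 -> lie (J x) y = - J y -> lie y (J y) = - J x ->
  holomorphic_image (aff_C_J2 R) <<[:: x; y; J x; J y]>>.
Proof.
move=> h h1 h2 h3; have h' : lie (J x) x = - J x by rewrite lieC h.
have h1' : lie y x = 0 by rewrite lieC h1 oppr0.
have h2' : lie (J y) x = - J y by rewrite (lieJC acs).
have h3' : lie (J y) y = J x by rewrite lieC h3 opprK.
by model [:: x; y; J x; J y]; close (h1, h2, h', h1', h2', h3').
Qed.

Section ProductMap.
Variables (W1 W2 : vectType R) (g1 : 'Hom(W1, V)) (g2 : 'Hom(W2, V)).

Definition sum_map_fun (w : W1 * W2) : V := g1 w.1 + g2 w.2.

Fact sum_map_fun_linear : linear sum_map_fun.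
Proof. by move=> a x y; rewrite /sum_map_fun /= !linearP scalerDr addrACA. Qed.

HB.instance Definition _ := GRing.isLinear.Build R (W1 * W2)%type V
  *:%R sum_map_fun sum_map_fun_linear.

Lemma limg_sum_map : limg (linfun sum_map_fun) = (limg g1 + limg g2)%VS.
Proof.
apply/eqP; rewrite eqEsubv; apply/andP; split; apply/subvP => v.
  case/memv_imgP => w _ ->; rewrite lfunE.
  by apply: memv_add; apply: memv_img; apply: memvf.
case/memv_addP => _ /memv_imgP[w1 _ ->] [_ /memv_imgP[w2 _ ->] ->].
by apply/memv_imgP; exists (w1, w2); rewrite ?memvf // lfunE.
Qed.

End ProductMap.

Lemma holomorphic_image_prod (W1 W2 : lieAlgType R) (K1 : 'End(W1))
    (K2 : 'End(W2)) U1 U2 :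
  holomorphic_image K1 U1 -> holomorphic_image K2 U2 ->
  (forall x y, x \in U1 -> y \in U2 -> lie x y = 0) ->
  holomorphic_image (prod_end K1 K2) (U1 + U2).
Proof.
move=> [g1 [g1L g1J <-]] [g2 [g2L g2J <-]] U12.
have {}U12 x y : lie (g1 x) (g2 y) = 0 by apply: U12; apply: memv_img; apply: memvf.
have U21 x y : lie (g2 x) (g1 y) = 0 by rewrite lieC U12 oppr0.
exists (linfun (sum_map_fun g1 g2)); split; last exact: limg_sum_map.
  move=> x y; rewrite !lfunE /= /sum_map_fun !lieE U12 U21 addr0 add0r.
  by rewrite -g1L -g2L.
move=> x; rewrite (lfunE (prod_end_fun _ _)) !lfunE /= /sum_map_fun /= JD.
by rewrite g1J g2J.
Qed.

(** Surjectivity and equal dimensions make the model map [g] injective; its inverse is the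
    isomorphism. *)
Lemma holomorphic_image_iso (W : lieAlgType R) (K : 'End(W)) U :
  holomorphic_image K U -> U = fullv -> \dim {:V} = \dim {:W} ->
  holomorphically_isomorphic J K.
Proof.
move=> [g [gL gJ <-]] g_full eq_dim.
have ker_g : lker g == 0%VS.
  have := limg_ker_dim g fullv; rewrite g_full eq_dim capfv => h.
  by rewrite -dimv_eq0 -(eqn_add2r (\dim {:W})) h.
have gK := lker0_lfunK ker_g.
have gVK : cancel (g^-1)%VF g by move=> x; apply: limg_lfunVK; rewrite g_full memvf.
exists (g^-1)%VF; split; first by exists g.
  by move=> x y; apply: (can_inj gK); rewrite gL !gVK.
by move=> x; apply: (can_inj gK); rewrite gJ !gVK.
Qed.

End Models.

(** * Classification *)

Section Lines.
Variables (K : fieldType) (V : vectType K).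
Implicit Types (U W : {vspace V}) (x y a : V).

Lemma dim_add_line W a : a \notin W -> \dim (W + <[a]>) = (\dim W).+1.
Proof.
move=> aW; have a0 : a != 0 by apply: contraNneq aW => ->; apply: mem0v.
rewrite dimv_disjoint_sum ?dim_vline ?a0 ?addn1 //; apply/eqP.
rewrite -subv0; apply/subvP => x; rewrite memv_cap => /andP[xW /vlineP[k xk]].
case: (eqVneq k 0) => [k0|k0]; first by rewrite xk k0 scale0r mem0v.
by case/negP: aW; rewrite -[a]scale1r -(mulVf k0) -scalerA -xk memvZ.
Qed.

Lemma memv_add_line W U a x : (W <= U)%VS -> a \in U -> a \notin W ->
  \dim U = (\dim W).+1 -> x \in U -> exists2 w, w \in W & exists k, x = w + k *: a.
Proof.
move=> WU aU aW dimU xU.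
have : x \in (W + <[a]>)%VS.
  suff /eqP-> : (W + <[a]>)%VS == U by [].
  by rewrite eqEdim dim_add_line // dimU leqnn subv_add WU -memvE aU.
by case/memv_addP => w wW [_ /vlineP[k ->] ->]; exists w => //; exists k.
Qed.

Lemma notin_subv U W : (\dim U < \dim W)%N -> exists2 x, x \in W & x \notin U.
Proof.
move=> lt_UW; have /subvPn[x] : ~~ (W <= U)%VS.
  by apply: contraL lt_UW => /dimvS; rewrite leqNgt.
by exists x.
Qed.

End Lines.

(** * The product [J x, y] on the derived algebra *)

Section Classification.
Variables (R : rcfType) (V : lieAlgType R) (J : 'End(V)).
Hypothesis acs : abelian_complex_structure J.

Local Notation A := (derived_algebra V).
Local Notation "x ** y" := (lie (J x) y) (at level 40).
Local Notation lieJr := (lieJr acs).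
Local Notation lieJC := (lieJC acs).
Local Notation JK := (JK acs).

Lemma memv_derived x y : lie x y \in A.
Proof. exact: memv_commutator (memvf _) (memvf _). Qed.

(** [lie_metabelian] treats single brackets; it extends to their span one argument at a time,
    through the kernel of [lie u]. *)
Lemma derived_abelian x y : x \in A -> y \in A -> lie x y = 0.
Proof.
have commP u (U : {vspace V}) :
  (forall v, v \in U -> lie u v = 0) <-> (U <= lker (linfun (lie u)))%VS.
  split=> [h|/subvP h v /h]; last by rewrite memv_ker lfunE /= => /eqP.
  by apply/subvP => v /h; rewrite memv_ker lfunE /= => ->.
have half u v : forall w, w \in A -> lie (lie u v) w = 0.
  apply/commP/commutator_subP => a b _ _.
  by rewrite memv_ker lfunE /= (lie_metabelian acs).
move=> Ax; move: y; apply/commP/commutator_subP => a b _ _.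
by rewrite memv_ker lfunE /= lieC half // oppr0.
Qed.

(** The commutator of ad x and ad y is ad [x, y], which vanishes on the abelian A. *)
Lemma lie_derivedC x y z : z \in A -> lie x (lie y z) = lie y (lie x z).
Proof.
by move=> Az; rewrite lie_leibniz derived_abelian ?memv_derived // add0r.
Qed.

(** This is the Leibniz rule for [f] and [J f] at [J x]. Where the right side vanishes, eigenvalues
    satisfy p^2 + q^2 = 0, hence are zero over the reals. *)
Lemma lie_sqr f x :
  lie f (lie f x) + lie (J f) (lie (J f) x) = - (lie f (J f) ** x).
Proof.
have := lie_leibniz f (J f) (J x).
by rewrite (lieJJ acs) lieJr [lie f (J x)]lieJr lieNr => ->; rewrite subrK.
Qed.

Lemma holomorphic_image_stable (W : lieAlgType R) (K : 'End(W)) U x :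
  holomorphic_image J K U -> x \in U -> J x \in U.
Proof.
move=> [g [_ gJ <-]] /memv_imgP[w _ ->].
by rewrite -gJ memv_img ?memvf.
Qed.

Lemma commute_span (X Y : seq V) x y :
  all (fun x => all (fun y => lie x y == 0) Y) X ->
  x \in <<X>>%VS -> y \in <<Y>>%VS -> lie x y = 0.
Proof.
move=> /allP XY; have commP u (Z : seq V) : (forall v, v \in Z -> lie u v = 0) ->
  forall v, v \in <<Z>>%VS -> lie u v = 0.
  move=> h v; have /subvP/(_ v) : (<<Z>> <= lker (linfun (lie u)))%VS.
    by apply/span_subvP => z /h; rewrite memv_ker lfunE /= => ->.
  by rewrite memv_ker lfunE /= => sub /sub/eqP.
move=> Xx; apply: (commP x Y) => v Yv; rewrite lieC.
apply/eqP; rewrite oppr_eq0; apply/eqP; move: x Xx; apply: (commP v X) => u /XY/allP h.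
by rewrite lieC (eqP (h _ Yv)) oppr0.
Qed.

(** The generator e_1 is [J a], since [J a, J (J a)] = - a = J (J a). *)
Lemma holomorphic_image_idempotent a : a ** a = a ->
  holomorphic_image J (aff_R_J R) <<[:: J a; J (J a)]>>.
Proof.
by move=> aa; apply: (holomorphic_image_aff_R acs); rewrite JK lieNr aa.
Qed.

(** * Vectors transversal to A + J A *)

Hypothesis dimV : \dim {:V} = 6%N.
Hypothesis dimAJ : \dim (derived_algebra_J J) = 4%N.

Local Notation transversal f := (f \notin derived_algebra_J J).

Lemma memv_derived_J x y : x \in A -> y \in A -> x + J y \in derived_algebra_J J.
Proof. by move=> Ax Ay; apply: memv_add => //; apply: memv_img. Qed.

Lemma derived_J_stable x : (J x \in derived_algebra_J J) = (x \in derived_algebra_J J).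
Proof.
have h y : y \in derived_algebra_J J -> J y \in derived_algebra_J J.
  case/memv_addP => a Aa [_ /memv_imgP[b Ab ->] ->].
  by rewrite !(JE acs) addrC memv_derived_J // memvN.
apply/idP/idP => [|/h //]; by move/h; rewrite JK memvN.
Qed.

Lemma transversal_sum f x y : transversal f -> x \in A -> y \in A ->
  transversal (f + x + J y).
Proof.
move=> fT Ax Ay; apply: contra fT => h.
by rewrite -(addrK (x + J y) f) memvB ?memv_derived_J // addrA.
Qed.

(** The operator a - b J inverts a + b J up to the factor a^2 + b^2 and preserves A + J A. *)
Lemma transversal_rescale f a b : transversal f -> a ^+ 2 + b ^+ 2 != 0 ->
  transversal (a *: f + b *: J f).
Proof.
move=> fT a0; apply: contra fT => h.
have := memvB (memvZ a h) (memvZ b (etrans (derived_J_stable _) h)).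
have -> : a *: (a *: f + b *: J f) - b *: J (a *: f + b *: J f) =
    (a ^+ 2 + b ^+ 2) *: f by rewrite !(JE acs); vring.
move=> /(memvZ (a ^+ 2 + b ^+ 2)^-1); by rewrite scalerA mulVf // scale1r.
Qed.

Lemma transversal_decomp f v : transversal f ->
  exists a b c d, [/\ a \in A, b \in A & v = a + J b + c *: f + d *: J f].
Proof.
move=> fT; set U := derived_algebra_J J; set W := (U + <[f]>)%VS.
have dimW : \dim W = 5%N by rewrite dim_add_line // dimAJ.
have JfW : J f \notin W.
  apply/negP => /memv_addP[u uU [_ /vlineP[k ->] Jf]].
  (* If [J f = u + k *: f], then the nonzero complex multiple - k f + J f of [f] would lie in A + J
     A. *)
  have k1 : (- k) ^+ 2 + 1 ^+ 2 != 0 by rewrite gt_eqF //; nra.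
  have := transversal_rescale fT k1; rewrite scale1r Jf.
  by rewrite addrC scaleNr addrK uU.
have [w /memv_addP[u /memv_addP[a Aa [_ /memv_imgP[b Ab ->] ->]]]] :=
  memv_add_line (subvf W) (memvf (J f)) JfW (etrans dimV (esym (congr1 S dimW))) (memvf v).
move=> [_ /vlineP[c ->] ->] [d ->]; exists a, b, c, d; split=> //.
Qed.

(** By [transversal_decomp] and [J u, z] = - [u, J z], only brackets with [f] and with elements of A
    matter. Applied to a subspace too small to contain A, this yields contradictions. *)
Lemma derived_sub f (U : {vspace V}) : transversal f ->
  (forall x y, x \in A -> y \in A -> x ** y \in U) ->
  (forall x, x \in A -> lie f x \in U) ->
  (forall x, x \in A -> lie (J f) x \in U) ->
  lie f (J f) \in U -> (A <= U)%VS.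
Proof.
move=> fT UA UP UQ Uv; apply/commutator_subP => x y _ _.
have UJ u : (forall z, lie u z \in U) -> forall z, u ** z \in U.
  by move=> h z; have := h (J z); rewrite lieJr memvN.
have UAl a z : a \in A -> lie a z \in U.
  move=> Aa; have [a' [b' [c' [d' [Aa' Ab' ->]]]]] := transversal_decomp z fT.
  rewrite !lieE derived_abelian // add0r lieJr ![lie a _]lieC.
  by rewrite !memvD ?memvZ ?memvN ?UP ?UQ ?UA.
have Uf z : lie f z \in U.
  have [a' [b' [c' [d' [Aa' Ab' ->]]]]] := transversal_decomp z fT.
  rewrite !lieE lie_alternating scaler0 addr0 [lie f (J b')]lieJr.
  by rewrite !memvD ?memvZ ?memvN ?Uv ?UP ?UQ.
have [a [b [c [d [Aa Ab ->]]]]] := transversal_decomp x fT.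
by rewrite !lieE !memvD ?memvZ ?Uf ?(UJ f Uf) ?(UJ b (fun z => UAl b z Ab)) ?UAl.
Qed.

Lemma transversal_full f (U : {vspace V}) : transversal f ->
  (forall x, x \in U -> J x \in U) -> f \in U -> (A <= U)%VS -> U = fullv.
Proof.
move=> fT UJ Uf /subvP AU; apply/eqP; rewrite eqEsubv subvf /=; apply/subvP => v _.
have [a [b [c [d [Aa Ab ->]]]]] := transversal_decomp v fT.
by rewrite !memvD ?memvZ ?UJ ?Uf ?AU.
Qed.

Lemma holomorphic_iso (W : lieAlgType R) (K : 'End(W)) f U :
  holomorphic_image J K U -> transversal f -> f \in U -> (A <= U)%VS ->
  \dim {:W} = 6%N -> holomorphically_isomorphic J K.
Proof.
move=> hU fT Uf AU dimW; apply: (holomorphic_image_iso hU); last by rewrite dimV.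
apply: (transversal_full fT _ Uf AU) => x; exact: holomorphic_image_stable hU.
Qed.

(** With p = [f, a] and q = [J f, a], both fixed by multiplication by [a], the vector g = f - q - J
    p works: J p and J q act on [a] as p and q do under the product, and A is abelian. The last
    claim is then [lie_sqr] at [a]. *)
Lemma transversal_normalize f a : a \in A -> a ** a = a -> transversal f ->
  exists g, [/\ transversal g, lie g a = 0, lie (J g) a = 0
    & lie g (J g) ** a = 0].
Proof.
move=> Aa aa fT; set p := lie f a; set q := lie (J f) a.
have Ap : p \in A by apply: memv_derived.
have Aq : q \in A by apply: memv_derived.
have pa : p ** a = p by rewrite lieJC /p lie_derivedC // aa.
have qa : q ** a = q by rewrite lieJC /q lie_derivedC // aa.
have ga : lie (f + - q + J (- p)) a = 0.
  by rewrite !(JE acs) !lieE pa [lie q a]derived_abelian // oppr0 addr0 subrr.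
have Jga : lie (J (f + - q + J (- p))) a = 0.
  by rewrite !(JE acs) opprK !lieE qa [lie p a]derived_abelian // addr0 subrr.
exists (f + - q + J (- p)); split=> //.
  by rewrite transversal_sum ?memvN.
by have := lie_sqr (f + - q + J (- p)) a; rewrite ga Jga !lie0r addr0 => /eqP;
  rewrite eq_sym oppr_eq0 => /eqP.
Qed.

(** * Two-dimensional derived algebra: unital and null cases *)

Lemma memv_derived_span (a b x : V) : \dim A = 2%N -> a != 0 -> a \in A -> b \in A ->
  b \notin <[a]>%VS -> x \in A -> exists k l, x = k *: a + l *: b.
Proof.
move=> dimA a0 Aa Ab ab Ax.
have aA : (<[a]> <= A)%VS by rewrite -memvE.
have [|_ /vlineP[k ->] [l ->]] := memv_add_line aA Ab ab _ Ax.
  by rewrite dimA dim_vline a0.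
by exists k, l.
Qed.

(** Each x in A is x ** a, and ad g and ad (J g) commute with the product, so killing the unit kills
    all of A. *)
Lemma unital_transversal f a : a \in A -> (forall x, x \in A -> a ** x = x) ->
  transversal f -> exists g, [/\ transversal g, forall x, x \in A -> lie g x = 0,
    forall x, x \in A -> lie (J g) x = 0 & lie g (J g) = 0].
Proof.
move=> Aa a1 fT; have [g [gT ga Jga va]] := transversal_normalize Aa (a1 a Aa) fT.
exists g; split=> //.
- by move=> x Ax; rewrite -(a1 x Ax) [a ** x]lieJC lie_derivedC // ga lie0r.
- by move=> x Ax; rewrite -(a1 x Ax) [a ** x]lieJC lie_derivedC // Jga lie0r.
- by rewrite -(a1 (lie g (J g))) ?memv_derived // lieJC.
Qed.

(** Completing the square in b ** b = k a + l b makes (b - (l / 2) a)^2 equal to d a; rescaling by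
    the square root of |d| leaves only the sign of d. *)
Lemma unital_quadratic a : \dim A = 2%N -> a != 0 -> a \in A ->
  (forall x, x \in A -> a ** x = x) -> exists c, [/\ c \in A, c \notin <[a]>%VS &
  [\/ c ** c = 0, c ** c = a | c ** c = - a]].
Proof.
move=> dimA a0 Aa a1.
have [b Ab ab] : exists2 b, b \in A & b \notin <[a]>%VS.
  by apply: notin_subv; rewrite dim_vline a0 dimA.
have [k [l bb]] := memv_derived_span dimA a0 Aa Ab ab (memv_derived (J b) b).
set d := k + l ^+ 2 / 4.
have scaled (r : R) : r != 0 -> r *: (b - (l / 2) *: a) \notin <[a]>%VS.
  move=> r0; apply: contra ab => /(memvZ r^-1); rewrite scalerA mulVf // scale1r.
  by move/(memvD (memvZ (l / 2) (memv_line a))); rewrite addrC subrK.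
have square r : (r *: (b - (l / 2) *: a)) ** (r *: (b - (l / 2) *: a)) =
    (r ^+ 2 * d) *: a.
  rewrite !(JE acs) !lieE bb !a1 // [b ** a]lieJC a1 // /d.
  by apply: vect_ext => p pD pZ pN p0; rewrite !(pD, pZ, pN); field.
have Ac r : r *: (b - (l / 2) *: a) \in A by rewrite memvZ ?memvB ?memvZ.
have pos (x : R) : 0 < x -> exists2 r, r != 0 & r ^+ 2 * x = 1.
  move=> x0; have s0 : Num.sqrt x != 0 by rewrite sqrtr_eq0 -ltNge.
  exists (Num.sqrt x)^-1; first by rewrite invr_eq0.
  by rewrite -{2}(sqr_sqrtr (ltW x0)) -exprMn mulVf ?expr1n.
case: (ltgtP d 0) => [d0|d0|d0].
- have [r r0 rd] := pos (- d) ltac:(by rewrite oppr_gt0).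
  exists (r *: (b - (l / 2) *: a)); split; rewrite ?scaled // square.
  by constructor 3; rewrite -[_ * d]opprK -mulrN rd scaleN1r.
- have [r r0 rd] := pos d d0.
  by exists (r *: (b - (l / 2) *: a)); split; rewrite ?scaled // square rd scale1r;
     constructor 2.
- exists (1 *: (b - (l / 2) *: a)); split; rewrite ?scaled ?oner_neq0 // square.
  by constructor 1; rewrite d0 mulr0 scale0r.
Qed.

Ltac in_span := by rewrite memv_span // !inE eqxx ?orbT.
Ltac commute h := rewrite /= ?lieNr ?lieJr ?(JE acs) ?lieE ?h ?oppr0 ?eqxx.

(** The three squares of [c] give the dual numbers, R x R and C. The normalized [g] spans, with
    [J g], a commuting abelian factor. *)
Lemma unital_case f a : transversal f -> \dim A = 2%N -> a != 0 -> a \in A ->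
  (forall x, x \in A -> a ** x = x) ->
  [\/ holomorphically_isomorphic J
        (prod_end (prod_end (aff_R_J R) (aff_R_J R)) (R2_J R)),
      holomorphically_isomorphic J (prod_end (aff_R_ad_J R) (R2_J R)) |
      holomorphically_isomorphic J (prod_end (aff_C_J2 R) (R2_J R))].
Proof.
move=> fT dimA a0 Aa a1; have [g [gT gA JgA v0]] := unital_transversal Aa a1 fT.
have [c [Ac ca cc]] := unital_quadratic dimA a0 Aa a1.
have gU U1 : g \in (U1 + <<[:: g; J g]>>)%VS.
  by apply: (subvP (addvSr _ _)); in_span.
have hR2 := holomorphic_image_R2 acs v0.
have subU (U : {vspace V}) : J (J a) \in U -> J (J c) \in U -> (A <= U)%VS.
  rewrite !JK !memvN => Ua Uc; apply/subvP => x Ax.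
  have [k [l ->]] := memv_derived_span dimA a0 Aa Ac ca Ax.
  by rewrite memvD ?memvZ.
have ac : a ** c = c by apply: a1.
have ca' : c ** a = c by rewrite lieJC.
have aa : a ** a = a by apply: a1.
have Jg x : x \in A -> lie (J x) g = 0.
  by move=> Ax; rewrite lieC lieJr JgA // !oppr0.
have Jg2 x : x \in A -> lie x g = 0.
  by move=> Ax; rewrite lieC gA // !oppr0.
have lac : lie a c = 0 by rewrite derived_abelian.
case: cc => cc.
- constructor 2; have h : holomorphic_image J (aff_R_ad_J R)
      <<[:: J a; J (J a); J c; - J (J c)]>>.
    by apply: (holomorphic_image_aff_R_ad acs);
      rewrite ?lieJr ?JK ?lieE ?aa ?ac ?cc ?lac ?opprK ?oppr0.
  apply: (holomorphic_iso (f := g) (holomorphic_image_prod h hR2 _)) => //.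
  + move=> x y; apply: commute_span.
    by commute (Jg _ Aa, Jg _ Ac, Jg2 _ Aa, Jg2 _ Ac).
  + apply: subU; apply: (subvP (addvSl _ _)); last rewrite -memvN; in_span.
  by rewrite dimvf.
(* For c ** c = a, these are orthogonal idempotents with sum [a], one for each factor aff(R). *)
- constructor 1; set p := 2^-1 *: (a + c); set q := 2^-1 *: (a - c).
  have pp : p ** p = p.
    by rewrite /p !(JE acs) !lieE aa ac ca' cc; vfield.
  have qq : q ** q = q.
    by rewrite /q !(JE acs) !lieE aa ac ca' cc; vfield.
  have pq : p ** q = 0.
    by rewrite /p /q !(JE acs) !lieE aa ac ca' cc; vfield.
  have Ap : p \in A by rewrite memvZ ?memvD.
  have Aq : q \in A by rewrite memvZ ?memvB.
  have lpq : lie p q = 0 by rewrite derived_abelian.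
  have a_pq : a = p + q by rewrite /p /q; vfield.
  have c_pq : c = p - q by rewrite /p /q; vfield.
  clearbody p q.
  have h := holomorphic_image_prod (holomorphic_image_idempotent pp)
    (holomorphic_image_idempotent qq) _.
  have {}h := h ltac:(move=> x y; apply: commute_span; by commute (pq, lpq)).
  apply: (holomorphic_iso (f := g) (holomorphic_image_prod h hR2 _)) => //.
  + move=> _ y /memv_addP[x1 hx1 [x2 hx2 ->]] hy; rewrite lieDl.
    by rewrite (commute_span _ hx1 hy) ?(commute_span _ hx2 hy) ?addr0 //;
      commute (Jg _ Ap, Jg _ Aq, Jg2 _ Ap, Jg2 _ Aq).
  + have Up U2 : p \in (<<[:: J p; J (J p)]>> + <<[:: J q; J (J q)]>> + U2)%VS.
      apply: (subvP (addvSl _ _)); apply: (subvP (addvSl _ _)).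
      by rewrite -memvN -JK; in_span.
    have Uq U2 : q \in (<<[:: J p; J (J p)]>> + <<[:: J q; J (J q)]>> + U2)%VS.
      apply: (subvP (addvSl _ _)); apply: (subvP (addvSr _ _)).
      by rewrite -memvN -JK; in_span.
    apply: subU; rewrite JK memvN.
      by rewrite a_pq memvD.
    by rewrite c_pq memvB.
  by rewrite dimvf.
- constructor 3; have h : holomorphic_image J (aff_C_J2 R)
      <<[:: J a; J c; J (J a); J (J c)]>>.
    by apply: (holomorphic_image_aff_C_J2 acs);
      rewrite ?lieJr ?JK ?lieE ?aa ?ac ?cc ?lac ?opprK ?oppr0.
  apply: (holomorphic_iso (f := g) (holomorphic_image_prod h hR2 _)) => //.
  + move=> x y; apply: commute_span.
    by commute (Jg _ Aa, Jg _ Ac, Jg2 _ Aa, Jg2 _ Ac).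
  + by apply: subU; apply: (subvP (addvSl _ _)); in_span.
  by rewrite dimvf.
Qed.

Lemma sqr_sum_eq0 (p q : R) (x : V) : x != 0 -> (p ^+ 2 + q ^+ 2) *: x = 0 -> p = 0 /\ q = 0.
Proof.
move=> x0 /eqP; rewrite scaler_eq0 (negPf x0) orbF paddr_eq0 ?sqr_ge0 //.
by rewrite !sqrf_eq0 => /andP[/eqP-> /eqP->].
Qed.

(** Commutativity of the product moves [z] to the left, where multiplications commute as adjoint
    operators on A. *)
Lemma lie_assoc x y z : y \in A -> (x ** y) ** z = x ** (y ** z).
Proof. by move=> Ay; rewrite lieJC lie_derivedC // [z ** y]lieJC. Qed.

(** Adjoint operators preserve the annihilator R n of [a]. There [lie_sqr] forces ad g and ad (J g)
    to vanish, so [g, J g] = v is a multiple of [n] and g, J g, v, J v span the factor h_3 x R. *)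
Lemma null_case f a n : transversal f -> \dim A = 2%N -> a != 0 -> a \in A ->
  n \in A -> n \notin <[a]>%VS -> a ** a = a -> a ** n = 0 -> n ** n = 0 ->
  holomorphically_isomorphic J (prod_end (aff_R_J R) (h3_R_J R)).
Proof.
move=> fT dimA a0 Aa An an aa an0 nn.
have n0 : n != 0 by apply: contraNneq an => ->; apply: mem0v.
have na0 : n ** a = 0 by rewrite lieJC.
have annih x : x \in A -> a ** x = 0 -> exists l, x = l *: n.
  move=> Ax; have [k [l ->]] := memv_derived_span dimA a0 Aa An an Ax.
  rewrite !lieE aa an0 scaler0 addr0 => ->; exists l; by rewrite add0r.
have adn y : exists p, lie y n = p *: n.
  by apply: annih; rewrite ?memv_derived // lie_derivedC // an0 lie0r.
have [g [gT ga Jga va]] := transversal_normalize Aa aa fT.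
set v := lie g (J g) in va *; have Av : v \in A by apply: memv_derived.
have [r vE] : exists r, v = r *: n by apply: annih; rewrite // lieJC.
have [p gn] := adn g; have [q Jgn] := adn (J g).
have := lie_sqr g n; rewrite -/v gn Jgn !lieZr gn Jgn vE JZ lieZl nn scaler0 oppr0.
rewrite !scalerA -scalerDl -!expr2 => /(sqr_sum_eq0 n0)[p0 q0].
rewrite p0 scale0r in gn; rewrite q0 scale0r in Jgn.
(* If v were 0, [derived_sub] would confine A to the line of [a]. *)
have r0 : r != 0.
  apply: contraNneq (an) => r0.
  suff /subvP sub : (A <= <[a]>)%VS by apply: sub.
  apply: (derived_sub gT); last by rewrite -/v vE r0 scale0r mem0v.
  - move=> x y Ax Ay.
    have [k [l ->]] := memv_derived_span dimA a0 Aa An an Ax.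
    have [k' [l' ->]] := memv_derived_span dimA a0 Aa An an Ay.
    by rewrite !(JE acs) !lieE aa an0 na0 nn !scaler0 !addr0 !memvZ ?memv_line.
  - move=> x Ax; have [k [l ->]] := memv_derived_span dimA a0 Aa An an Ax.
    by rewrite !lieE ga gn !scaler0 addr0 mem0v.
  - move=> x Ax; have [k [l ->]] := memv_derived_span dimA a0 Aa An an Ax.
    by rewrite !lieE Jga Jgn !scaler0 addr0 mem0v.
have gv : lie g v = 0 by rewrite vE lieZr gn scaler0.
have Jgv : lie (J g) v = 0 by rewrite vE lieZr Jgn scaler0.
have vv : v ** v = 0 by rewrite vE JZ !lieE nn !scaler0.
have h := holomorphic_image_h3_R acs (erefl v) gv Jgv _.
have {}h := h ltac:(by rewrite lieJr vv oppr0).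
have av : a ** v = 0 by rewrite vE lieZr an0 scaler0.
have lav : lie a v = 0 by rewrite derived_abelian.
have aJg : a ** g = 0 by rewrite lieC lieJr Jga !oppr0.
have ag : lie a g = 0 by rewrite lieC ga oppr0.
apply: (holomorphic_iso (f := g)
  (holomorphic_image_prod (holomorphic_image_idempotent aa) h _)) => //.
- move=> x y; apply: commute_span.
  by commute (av, lav, aJg, ag).
- by apply: (subvP (addvSr _ _)); in_span.
- apply/subvP => x Ax; have [k [l ->]] := memv_derived_span dimA a0 Aa An an Ax.
  apply: memvD; apply: memvZ.
    by apply: (subvP (addvSl _ _)); rewrite -memvN -JK; in_span.
  have -> : n = r^-1 *: v by rewrite vE scalerA mulVf // scale1r.
  by apply: memvZ; apply: (subvP (addvSr _ _)); in_span.
by rewrite dimvf.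
Qed.

(** * Idempotents and the classification for dim A = 2 *)

Hypothesis nonabelian : ~ abelian_subspace (derived_algebra_J J).

(** By polarization, vanishing squares would kill the whole product and make A + J A abelian. *)
Lemma exists_square_neq0 : exists2 a, a \in A & a ** a != 0.
Proof.
apply: contrapT => h; have sq x : x \in A -> x ** x = 0.
  by move=> Ax; apply/eqP/negPn/negP => x0; apply: h; exists x.
have pr x y : x \in A -> y \in A -> x ** y = 0.
  move=> Ax Ay; have := sq _ (memvD Ax Ay).
  rewrite JD !lieE !sq // add0r addr0 [y ** x]lieJC => /eqP.
  by rewrite -mulr2n -scaler_nat scaler_eq0 pnatr_eq0 => /eqP.
apply: nonabelian => x y /memv_addP[a Aa [_ /memv_imgP[b Ab ->] ->]].
move=> /memv_addP[a' Aa' [_ /memv_imgP[b' Ab' ->] ->]].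
by rewrite !lieE (lieJJ acs) lieJr !pr ?derived_abelian // oppr0 !addr0.
Qed.

Lemma exists_idempotent2 f : transversal f -> \dim A = 2%N ->
  exists e, [/\ e \in A, e != 0 & e ** e = e].
Proof.
move=> fT dimA; have [a Aa aa0] := exists_square_neq0.
have a0 : a != 0 by apply: contraNneq aa0 => ->; rewrite lie0r.
have Ab : a ** a \in A by apply: memv_derived.
have [/vlineP[k aak]|ab] := boolP (a ** a \in <[a]>%VS).
  have k0 : k != 0 by apply: contraNneq aa0 => k0; rewrite aak k0 scale0r.
  exists (k^-1 *: a); split; rewrite ?memvZ ?scaler_eq0 ?negb_or ?invr_eq0 ?k0 //.
  by rewrite JZ !lieE aak !scalerA divfK //.
have [al [be abE]] := memv_derived_span dimA a0 Aa Ab ab (memv_derived (J a) (a ** a)).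
set b := a ** a in aa0 Ab ab abE *.
have bb : b ** b = a ** (a ** b) by rewrite lie_assoc.
have ba : b ** a = a ** b by rewrite lieJC.
have [al0|al0] := eqVneq al 0; last first.
  (* Here a^3 = al a + be a^2 with al nonzero; dividing by [a] formally gives the unit. *)
  set e := al^-1 *: (b - be *: a).
  have ea : e ** a = a.
    rewrite /e !(JE acs) !lieE ba abE -/b addrK scalerA mulVf ?scale1r //.
  have eb : e ** b = b by rewrite /b -lie_assoc // ea.
  exists e; split; first by rewrite memvZ ?memvB ?memvZ.
    by apply: contraNneq a0 => e0; rewrite -ea e0 J0 lie0l.
  by rewrite {2}/e !lieE eb ea.
have [be0|be0] := eqVneq be 0; last first.
  (* Now a^3 = be a^2, so b ** b = a^4 = be^2 b. *)
  exists ((be ^+ 2)^-1 *: b); split; first by rewrite memvZ.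
    by rewrite scaler_eq0 invr_eq0 expf_eq0 (negPf be0).
  rewrite JZ !lieE bb abE al0 scale0r add0r lieZr abE al0 scale0r add0r.
  by rewrite !scalerA -mulrA -expr2 divfK // expf_neq0.
(* The nilpotent case a^3 = 0 remains. [lie_sqr] at [b] removes the diagonal of ad f and ad (J f),
   then at [a] the [a]-part of [f, J f]; so A would lie in the line of [b]. *)
have {abE} ab0 : a ** b = 0 by rewrite abE al0 be0 !scale0r addr0.
rewrite ab0 lie0r in bb; rewrite ab0 in ba.
have ad y : exists p q, lie y a = p *: a + q *: b /\ lie y b = p *: b.
  have [p [q yE]] := memv_derived_span dimA a0 Aa Ab ab (memv_derived y a).
  exists p, q; split=> //.
  by rewrite {1}/b lie_derivedC // yE !lieE ab0 scaler0 addr0.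
have [p [p' [fa fb]]] := ad f; have [q [q' [Jfa Jfb]]] := ad (J f).
have [r [s vE]] := memv_derived_span dimA a0 Aa Ab ab (memv_derived f (J f)).
have [] : p = 0 /\ q = 0.
  apply: (sqr_sum_eq0 aa0); have := lie_sqr f b.
  rewrite fb Jfb !lieZr fb Jfb vE !(JE acs) !lieE ab0 bb !scaler0 addr0 oppr0 => <-.
  by rewrite -/b; vring.
move=> p0 q0; rewrite p0 q0 ?scale0r ?add0r in fa fb Jfa Jfb.
have r0 : r = 0.
  have := lie_sqr f a; rewrite fa Jfa !lieZr fb Jfb vE !(JE acs) !lieE ba !scaler0.
  rewrite !addr0 -/b => /eqP; rewrite eq_sym oppr_eq0 scaler_eq0 (negPf aa0) orbF.
  by move/eqP.
case/negP: (ab); have : a \in <[b]>%VS.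
  suff /subvP sub : (A <= <[b]>)%VS by apply: sub.
  apply: (derived_sub fT); last by rewrite vE r0 scale0r add0r memvZ ?memv_line.
  - move=> x y Ax Ay.
    have [k [l ->]] := memv_derived_span dimA a0 Aa Ab ab Ax.
    have [k' [l' ->]] := memv_derived_span dimA a0 Aa Ab ab Ay.
    by rewrite !(JE acs) !lieE ab0 ba bb !scaler0 !addr0 !memvZ ?memv_line.
  - move=> x Ax; have [k [l ->]] := memv_derived_span dimA a0 Aa Ab ab Ax.
    by rewrite !lieE fa fb scaler0 addr0 !memvZ ?memv_line.
  - move=> x Ax; have [k [l ->]] := memv_derived_span dimA a0 Aa Ab ab Ax.
    by rewrite !lieE Jfa Jfb scaler0 addr0 !memvZ ?memv_line.
case/vlineP => t at_b; rewrite at_b in a0; move: a0.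
rewrite scaler_eq0 negb_or => /andP[t0 _].
by apply/vlineP; exists t^-1; rewrite [in RHS]at_b scalerA mulVf // scale1r.
Qed.

(** Peirce decomposition for an idempotent [e]: n = b - e ** b is annihilated by [e]. If n = 0, [e]
    is a unit; otherwise n ** n = l n, and l decides between the null case and a unit. *)
Lemma dim2_case f : transversal f -> \dim A = 2%N ->
  [\/ holomorphically_isomorphic J (prod_end (aff_R_J R) (h3_R_J R)),
      holomorphically_isomorphic J
        (prod_end (prod_end (aff_R_J R) (aff_R_J R)) (R2_J R)),
      holomorphically_isomorphic J (prod_end (aff_R_ad_J R) (R2_J R)) |
      holomorphically_isomorphic J (prod_end (aff_C_J2 R) (R2_J R))].
Proof.
move=> fT dimA; have [e [Ae e0 ee]] := exists_idempotent2 fT dimA.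
have unital u : u \in A -> u != 0 -> (forall x, x \in A -> u ** x = x) -> _ :=
  fun Au u0 u1 => unital_case fT dimA u0 Au u1.
have [b Ab eb] : exists2 b, b \in A & b \notin <[e]>%VS.
  by apply: notin_subv; rewrite dim_vline e0 dimA.
set n := b - e ** b; have An : n \in A by rewrite memvB ?memv_derived.
have en : e ** n = 0.
  by rewrite /n lieDr lieNr -lie_assoc // ee subrr.
have [n0|n0] := eqVneq n 0.
  have [|||] := unital e Ae e0; [|by constructor 2|by constructor 3|by constructor 4].
  move=> x Ax; have [k [l ->]] := memv_derived_span dimA e0 Ae Ab eb Ax.
  by rewrite !lieE ee; congr (_ + _ *: _); apply/eqP; rewrite eq_sym -subr_eq0 -/n n0.
clearbody n.
have en_free : n \notin <[e]>%VS.
  apply: contraNN n0 => /vlineP[k nk]; move: en.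
  by rewrite nk lieZr ee => ->.
have [k [l nn]] := memv_derived_span dimA e0 Ae An en_free (memv_derived (J n) n).
have ne : n ** e = 0 by rewrite lieJC.
have k0 : k = 0.
  have : e ** (n ** n) = 0 by rewrite lie_derivedC // en lie0r.
  rewrite nn !lieE ee en scaler0 addr0 => /eqP.
  by rewrite scaler_eq0 (negPf e0) orbF => /eqP.
rewrite k0 scale0r add0r in nn.
have [l0|l0] := eqVneq l 0.
  rewrite l0 scale0r in nn; constructor 1.
  exact: (null_case fT dimA e0 Ae An en_free ee en nn).
(* For l nonzero, n / l is an idempotent orthogonal to [e], and their sum is the unit. *)
have [|||||] := unital (e + l^-1 *: n).
- by rewrite memvD ?memvZ.
- apply: contraNneq e0 => u0.
  have : e ** (e + l^-1 *: n) = e by rewrite !lieE ee en scaler0 addr0.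
  by rewrite u0 lie0r => <-.
- move=> x Ax; have [r [s ->]] := memv_derived_span dimA e0 Ae An en_free Ax.
  by rewrite !(JE acs) !lieE ee en ne nn !scaler0 [l^-1 *: (l *: n)]scalerA mulVf //; vring.
- by constructor 2.
- by constructor 3.
- by constructor 4.
Qed.

(** * Three-dimensional derived algebra *)

Local Notation Z := (A :&: J @: A)%VS.

Lemma memv_capJ z : (z \in Z) = (z \in A) && (J z \in A).
Proof.
rewrite memv_cap; apply: andb_id2l => Az; apply/memv_imgP/idP => [[x Ax ->]|AJz].
  by rewrite JK memvN.
by exists (- J z); rewrite ?memvN // JN JK opprK.
Qed.

Lemma capJ_derived z : z \in Z -> z \in A.
Proof. by rewrite memv_capJ => /andP[]. Qed.

Lemma capJ_stable z : z \in Z -> J z \in Z.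
Proof. by rewrite !memv_capJ JK memvN => /andP[-> ->]. Qed.

Lemma capJ_annihilator z x : z \in Z -> x \in A -> z ** x = 0.
Proof. by rewrite memv_capJ => /andP[_ AJz] Ax; rewrite derived_abelian. Qed.

Lemma J_independent (p q : R) z : z != 0 -> p *: z + q *: J z = 0 -> p = 0 /\ q = 0.
Proof.
move=> z0 pq; apply: (sqr_sum_eq0 z0).
have -> : (p ^+ 2 + q ^+ 2) *: z =
    p *: (p *: z + q *: J z) - q *: J (p *: z + q *: J z).
  by rewrite !(JE acs); vring.
by rewrite pq J0 !scaler0 subr0.
Qed.

Lemma capJ_span z x : \dim Z = 2%N -> z != 0 -> z \in Z -> x \in Z ->
  exists p q, x = p *: z + q *: J z.
Proof.
move=> dimZ z0 Zz Zx.
have zZ : (<[z]> <= Z)%VS by rewrite -memvE.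
have Jz : J z \notin <[z]>%VS.
  apply/vlineP => -[k Jzk]; have [] := @J_independent k (- 1) z z0.
    by rewrite Jzk scaleN1r subrr.
  by move=> _ /eqP; rewrite oppr_eq0 oner_eq0.
have [|_ /vlineP[p ->] [q ->]] := memv_add_line zZ (capJ_stable Zz) Jz _ Zx.
  by rewrite dimZ dim_vline z0.
by exists p, q.
Qed.

(* The operators ad f and ad (J f) of A commute and their squares cancel on Z;
   hence ad f is complex linear on the complex line Z. *)
Lemma capJ_complex_linear f z (p q : R) : \dim Z = 2%N -> z \in Z -> z != 0 ->
  lie (J f) z \in Z -> lie f z = p *: z + q *: J z ->
  lie (J f) z = q *: z - p *: J z.
Proof.
move=> dimZ Zz z0 ZJf fz; have [r [s Jfz]] := capJ_span dimZ z0 Zz ZJf.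
have Az := capJ_derived Zz.
have := lie_derivedC f (J f) Az; have := lie_sqr f z.
rewrite [lie f (J f) ** z]lieJC (capJ_annihilator Zz (memv_derived _ _)) oppr0.
rewrite {1}fz {1}Jfz [in lie (J f) (lie f z)]fz [in lie f (lie (J f) z)]Jfz.
rewrite !lieE ![lie f (J z)]lieJr (lieJJ acs).
set P := lie f z in fz *; set Q := lie (J f) z in Jfz *.
move=> h1 h2.
(* The defects r - q and p + s from complex linearity satisfy two relations whose combination shows
   that their sum of squares kills both P and Q. *)
have e1 : (r - q) *: P = (p + s) *: Q.
  apply: vect_ext => t tD tZ tN t0; move: (congr1 t h2).
  by rewrite !(tD, tZ, tN, t0); lra.
have e2 : (p + s) *: P = - ((r - q) *: Q).
  apply: vect_ext => t tD tZ tN t0; move: (congr1 t h1).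
  by rewrite !(tD, tZ, tN, t0); lra.
have P0 : ((p + s) ^+ 2 + (r - q) ^+ 2) *: P = 0.
  rewrite scalerDl !expr2 -!scalerA e1 e2 scalerN !scalerA [(r - q) * _]mulrC.
  by rewrite addNr.
have Q0 : ((p + s) ^+ 2 + (r - q) ^+ 2) *: Q = 0.
  rewrite scalerDl !expr2 -!scalerA -e1 -[(r - q) *: Q]opprK -e2 scalerN !scalerA.
  by rewrite [(r - q) * _]mulrC subrr.
have [PQ|PQ] := eqVneq ((p + s) ^+ 2 + (r - q) ^+ 2) 0.
  have [s0 r0] : p + s = 0 /\ r - q = 0.
    by apply: (sqr_sum_eq0 z0); rewrite PQ scale0r.
  have rE : r = q by lra.
  have sE : s = - p by lra.
  by rewrite Jfz rE sE scaleNr.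
move/eqP: P0; rewrite scaler_eq0 (negPf PQ) /= fz => /eqP/(J_independent z0)[-> ->].
move/eqP: Q0; rewrite scaler_eq0 (negPf PQ) /= => /eqP->.
by rewrite !scale0r subr0.
Qed.

Section Dimension3.
Hypotheses (dimA : \dim A = 3%N) (dimZ : \dim Z = 2%N).
Variable a : V.
Hypotheses (Aa : a \in A) (aa0 : a ** a != 0).

Lemma capJ_notin : a \notin Z.
Proof. by apply: contraNN aa0 => Za; rewrite capJ_annihilator. Qed.

Lemma derived_split x : x \in A -> exists2 z, z \in Z & exists k, x = z + k *: a.
Proof.
move=> Ax; apply: (memv_add_line (capvSl _ _) Aa capJ_notin _ Ax).
by rewrite dimA dimZ.
Qed.

Lemma mul_capJ z : z \in Z -> a ** z = 0.
Proof. by move=> Zz; rewrite lieJC capJ_annihilator. Qed.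

Lemma capJ_intro x : x \in A -> a ** x = 0 -> x \in Z.
Proof.
move=> /derived_split[z Zz [k ->]]; rewrite !lieE mul_capJ // add0r => /eqP.
by rewrite scaler_eq0 (negPf aa0) orbF => /eqP->; rewrite scale0r addr0.
Qed.

Lemma capJ_ad y z : z \in Z -> lie y z \in Z.
Proof.
move=> Zz; apply: capJ_intro; rewrite ?memv_derived //.
by rewrite lie_derivedC ?capJ_derived // mul_capJ // lie0r.
Qed.

Lemma derived_mul x y : x \in A -> y \in A -> exists k, x ** y = k *: (a ** a).
Proof.
move=> /derived_split[z Zz [k ->]] /derived_split[z' Zz' [k' ->]].
exists (k * k'); rewrite !(JE acs) !lieE !(capJ_annihilator Zz) ?(capJ_derived Zz') //.
by rewrite mul_capJ // !scaler0 !add0r scalerA mulrC.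
Qed.

(** If t = a ** a were in Z, it would be a real eigenvector of both ad f and ad (J f); complex
    linearity then makes both eigenvalues 0. So ad f and ad (J f) vanish on Z, [f, J f] lies in Z,
    and [derived_sub] puts A inside Z. *)
Lemma square_notin f : transversal f -> a ** a \notin Z.
Proof.
move=> fT; apply/negP; set t := a ** a => Zt; have At := capJ_derived Zt.
have ad y : exists2 z, z \in Z & exists k, lie y a = z + k *: a /\ lie y t = k *: t.
  have [z Zz [k ya]] := derived_split (memv_derived y a).
  exists z => //; exists k; split=> //.
  by rewrite /t lie_derivedC // ya !lieE mul_capJ // add0r.
have [z Zz [p [fa ft]]] := ad f; have [z' Zz' [q [Jfa Jft]]] := ad (J f).
have [] : q = 0 /\ p = 0.
  apply: (@J_independent q p t) => //.
  have := @capJ_complex_linear f t p 0 dimZ Zt aa0 (capJ_ad _ Zt).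
  by rewrite Jft scale0r addr0 => /(_ ft) ->; rewrite scale0r add0r addNr.
move=> q0 p0; rewrite {}p0 {}q0 !scale0r ?addr0 in fa ft Jfa Jft.
have adZ x : x \in Z -> lie f x = 0 /\ lie (J f) x = 0.
  move=> Zx; have [r [s ->]] := capJ_span dimZ aa0 Zt Zx.
  by rewrite !lieE !lieJr JK lieNl ft Jft !oppr0 !scaler0 addr0.
have Zv : lie f (J f) \in Z.
  apply: capJ_intro; first exact: memv_derived.
  have := lie_sqr f a; rewrite fa Jfa (adZ _ Zz).1 (adZ _ Zz').2 addr0 => /eqP.
  by rewrite eq_sym oppr_eq0 lieJC => /eqP.
case/negP: capJ_notin; suff /subvP sub : (A <= Z)%VS by apply: sub.
apply: (derived_sub fT) => //.
- by move=> x y Ax Ay; have [k ->] := derived_mul Ax Ay; apply: memvZ.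
- move=> _ /derived_split[x Zx [k ->]].
  by rewrite !lieE (adZ _ Zx).1 add0r fa memvZ.
- move=> _ /derived_split[x Zx [k ->]].
  by rewrite !lieE (adZ _ Zx).2 add0r Jfa memvZ.
Qed.

(** Modulo Z, a ** a is c a with c nonzero; as Z annihilates A, the square of a ** a is c^2 (a **
    a). *)
Lemma exists_idempotent3 f : transversal f ->
  exists e, [/\ e \in A, e != 0 & e ** e = e].
Proof.
move=> fT; have [z Zz [c aac]] := derived_split (memv_derived (J a) a).
have c0 : c != 0.
  by apply: contraNneq (square_notin fT) => c0; rewrite aac c0 scale0r addr0.
exists ((c ^+ 2)^-1 *: (a ** a)); split; first by rewrite memvZ ?memv_derived.
  by rewrite scaler_eq0 invr_eq0 expf_eq0 (negPf c0).
have tt : (a ** a) ** (a ** a) = c ^+ 2 *: (a ** a).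
  rewrite {1 2}aac !(JE acs) !lieE !(capJ_annihilator Zz) ?(capJ_derived Zz) //.
  by rewrite mul_capJ // !scaler0 !add0r scalerA expr2.
by rewrite JZ lieZl lieZr tt !scalerA divfK // expf_neq0.
Qed.

Lemma dim3_case f : transversal f -> a ** a = a ->
  holomorphically_isomorphic J (prod_end (aff_R_J R) (aff_C_J1 R)).
Proof.
move=> fT aa; have a0 : a != 0 by rewrite -aa.
have [g [gT ga Jga va]] := transversal_normalize Aa aa fT.
have [z Zz z0] : exists2 z, z \in Z & z != 0.
  by exists (vpick Z); rewrite ?memv_pick // vpick0 -dimv_eq0 dimZ.
have [p [q gz]] := capJ_span dimZ z0 Zz (capJ_ad g Zz).
have Jgz := capJ_complex_linear dimZ Zz z0 (capJ_ad (J g) Zz) gz.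
have [pq0|pq0] := eqVneq (p ^+ 2 + q ^+ 2) 0.
  have [p0 q0] : p = 0 /\ q = 0 by apply: (sqr_sum_eq0 z0); rewrite pq0 scale0r.
  rewrite p0 q0 !scale0r ?addr0 ?subr0 in gz Jgz.
  have adZ x : x \in Z -> lie g x = 0 /\ lie (J g) x = 0.
    move=> Zx; have [r [s ->]] := capJ_span dimZ z0 Zz Zx.
    by rewrite !lieE !lieJr JK lieNl gz Jgz !oppr0 !scaler0 addr0.
  (* If ad g vanished on Z, A would be spanned by [a] and [g, J g], contradicting dimension 3. *)
  suff /dimvS : (A <= <[a]> + <[lie g (J g)]>)%VS.
    move/leq_trans/(_ (dimv_add_leqif _ _).1); rewrite dimA !dim_vline.
    by case: (_ != 0); case: (_ != 0).
  apply: (derived_sub gT).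
  - move=> x y Ax Ay; have [k ->] := derived_mul Ax Ay.
    by rewrite aa memvZ // (subvP (addvSl _ _)) ?memv_line.
  - move=> _ /derived_split[x Zx [k ->]].
    by rewrite !lieE (adZ _ Zx).1 ga scaler0 addr0 mem0v.
  - move=> _ /derived_split[x Zx [k ->]].
    by rewrite !lieE (adZ _ Zx).2 Jga scaler0 addr0 mem0v.
  - by rewrite (subvP (addvSr _ _)) ?memv_line.
(* Dividing [g] by the complex eigenvalue of ad g on Z makes ad h the identity there. *)
pose h := (p / (p ^+ 2 + q ^+ 2)) *: g + (q / (p ^+ 2 + q ^+ 2)) *: J g.
have hT : transversal h.
  apply: transversal_rescale => //.
  set N := p ^+ 2 + q ^+ 2 in pq0 *.
  by rewrite !expr_div_n -mulrDl mulf_neq0 // invr_eq0 expf_neq0.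
have ha : lie h a = 0 by rewrite /h !lieE ga Jga !scaler0 addr0.
have Jha : lie (J h) a = 0.
  by rewrite /h !(JE acs) !lieE ga Jga oppr0 !scaler0 addr0.
have hz : lie h z = z by rewrite /h !lieE gz Jgz; vfield.
have Jhz : lie (J h) z = - J z by rewrite /h !(JE acs) !lieE gz Jgz; vfield.
clearbody h; have adJ x : x \in Z -> lie (J h) x = - J x.
  move=> Zx; have [r [s ->]] := capJ_span dimZ z0 Zz Zx.
  by rewrite !(JE acs) !lieE (lieJJ acs) Jhz hz; vring.
clear g gT ga Jga va gz Jgz.
set v := lie h (J h); have Zv : v \in Z.
  apply: capJ_intro; first exact: memv_derived.
  have := lie_sqr h a; rewrite ha Jha !lie0r addr0 lieJC => /eqP.
  by rewrite eq_sym oppr_eq0 => /eqP.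
(* Shifting [h] by w in Z adds [h, J w] + [w, J h] = 2 J w to [h, J h] = v, so J w = - v / 2 makes
   the new vector commute with its image under [J]. *)
have [w [Zw Jw]] : exists w, w \in Z /\ J w = - (2^-1 *: v).
  exists (2^-1 *: J v); rewrite JZ JK scalerN; split=> //.
  by rewrite memvZ ?capJ_stable.
have Aw := capJ_derived Zw; have AJw := capJ_derived (capJ_stable Zw).
have Az := capJ_derived Zz; have AJz := capJ_derived (capJ_stable Zz).
have hwT : transversal (h + w).
  by rewrite -[h + w]addr0 -(J0 J) transversal_sum ?mem0v.
have gg : lie (h + w) (J (h + w)) = 0.
  rewrite !(JE acs) !lieE [lie w (J w)]derived_abelian // [lie h (J w)]lieJr.
  by rewrite [lie w (J h)]lieC adJ // -/v Jw; vfield.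
have ga : lie (h + w) a = 0 by rewrite lieDl ha derived_abelian // addr0.
have Jga : lie (J (h + w)) a = 0.
  by rewrite JD lieDl Jha derived_abelian // addr0.
have gz : lie (h + w) z = z by rewrite lieDl hz derived_abelian // addr0.
have Jgz : lie (J (h + w)) z = - J z.
  by rewrite JD lieDl Jhz derived_abelian // addr0.
move: (h + w) hwT gg ga Jga gz Jgz => {}g gT gg ga Jga gz Jgz.
have hJ1 := holomorphic_image_aff_C_J1 acs gg gz Jgz (derived_abelian Az AJz).
have aJg : a ** g = 0 by rewrite lieC lieJr Jga !oppr0.
have ag : lie a g = 0 by rewrite lieC ga oppr0.
have az : a ** z = 0 by apply: mul_capJ.
have laz : lie a z = 0 by rewrite derived_abelian.
apply: (holomorphic_iso (f := g)
  (holomorphic_image_prod (holomorphic_image_idempotent aa) hJ1 _)) => //.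
- move=> x y; apply: commute_span.
  by commute (aJg, ag, az, laz).
- by apply: (subvP (addvSr _ _)); in_span.
- apply/subvP => _ /derived_split[x Zx [k ->]].
  have [r [s ->]] := capJ_span dimZ z0 Zz Zx.
  apply: memvD; last first.
    by apply/memvZ/(subvP (addvSl _ _)); rewrite -memvN -JK; in_span.
  by apply: (subvP (addvSr _ _)); rewrite memvD ?memvZ //; in_span.
by rewrite dimvf.
Qed.

End Dimension3.

(** * Dimension count and conclusion *)

(** Since [J] is injective, 4 + dim Z = 2 dim A. Dimension 4 would make A + J A equal to the abelian
    A. *)
Lemma dim_derived_cases :
  \dim A = 2%N \/ \dim A = 3%N /\ \dim Z = 2%N.
Proof.
have dimJA : \dim (J @: A) = \dim A.
  apply: limg_dim_eq; apply/eqP; rewrite -subv0; apply/subvP => x.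
  rewrite memv_cap memv_ker memv0 => /andP[_ /eqP Jx].
  by rewrite -oppr_eq0 -JK Jx J0.
have := dimv_sum_cap A (J @: A); rewrite dimAJ dimJA => dimE.
have : (\dim A <= 4)%N by rewrite -dimAJ dimvS // addvSl.
rewrite leq_eqVlt => /orP[/eqP dim4|dim4]; last first.
  case: (\dim A) dimE dim4 => [|[|[|[|]]]] // dimE _; [by left | right; split=> //].
  by apply/eqP; rewrite -(eqn_add2l 4) dimE.
case: nonabelian => x y.
have /eqP <- : A == derived_algebra_J J by rewrite eqEdim addvSl dimAJ dim4.
exact: derived_abelian.
Qed.

Lemma classification :
  [\/ holomorphically_isomorphic J (prod_end (aff_R_J R) (h3_R_J R)),
      holomorphically_isomorphic J (prod_end (aff_R_J R) (aff_C_J1 R)),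
      holomorphically_isomorphic J
        (prod_end (prod_end (aff_R_J R) (aff_R_J R)) (R2_J R)) |
      holomorphically_isomorphic J (prod_end (aff_R_ad_J R) (R2_J R)) \/
      holomorphically_isomorphic J (prod_end (aff_C_J2 R) (R2_J R))].
Proof.
have [f _ fT] : exists2 f, f \in {:V}%VS & transversal f.
  by apply: notin_subv; rewrite dimAJ dimV.
have [dimA|[dimA dimZ]] := dim_derived_cases.
  case: (dim2_case fT dimA) => h; [by constructor 1 | by constructor 3 | |].
    by constructor 4; left.
  by constructor 4; right.
have [a Aa aa0] := exists_square_neq0.
have [e [Ae e0 ee]] := exists_idempotent3 dimA dimZ Aa aa0 fT.
by constructor 2; apply: (dim3_case dimA dimZ Ae _ fT ee); rewrite ee.
Qed.

End Classification.

Theorem theorem4p2 (R : realType) (s : lieAlgType R) (J : 'End(s)) :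
  \dim {:s} = 6%N ->
  abelian_complex_structure J ->
  \dim (derived_algebra_J J) = 4%N ->
  ~ abelian_subspace (derived_algebra_J J) ->
  [\/ holomorphically_isomorphic J (prod_end (aff_R_J R) (h3_R_J R)),
      holomorphically_isomorphic J (prod_end (aff_R_J R) (aff_C_J1 R)),
      holomorphically_isomorphic J
        (prod_end (prod_end (aff_R_J R) (aff_R_J R)) (R2_J R)) |
      holomorphically_isomorphic J (prod_end (aff_R_ad_J R) (R2_J R)) \/
      holomorphically_isomorphic J (prod_end (aff_C_J2 R) (R2_J R))].
Proof.
by move=> dimV acs dimAJ nonabelian; apply: (classification acs dimV dimAJ nonabelian).
Qed.
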